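(* Consider the FJ-FA system with availability one and locality two (defined in the context), with systematic service rate $\gamma$ and recovery service rates $\mu$, and let $\nu = \gamma+2\mu$. Then the limiting fractions $f_0$ and $f_1$ of requests served with type-0 and type-1 service satisfy $$f_0 \ge \frac{\gamma\nu}{\gamma\nu + 2\mu^2}, \qquad f_1 \le \frac{2\mu^2}{\gamma\nu + 2\mu^2}.$$
   Context: Three servers store $a$ (systematic server), $b$ and $a+b$ (the two servers of the single recovery group for $a$). Requests arrive as a Poisson process of rate $\lambda$, and every request asks for $a$ (FJ-FA). Each request is replicated into a copy at the systematic server and a copy at the recovery group; the latter is forked into one sub-copy at each of the two recovery servers and completes when both finish. The request completes as soon as its systematic copy finishes or its recovery-group copy completes, and all its outstanding copies/sub-copies are then removed immediately. Each server has a FCFS queue and serves one sub-copy at a time; service times are independent, $\mathrm{Exp}(\gamma)$ at the systematic server and $\mathrm{Exp}(\mu)$ at each recovery server. A request is at the head of the line (HoL) once all its copies still in the system are in service; at that moment it starts service. Its service is of type 1 if one of its two recovery sub-copies had already finished service before it reached HoL, and of type 0 otherwise. The system is assumed stable, and $f_0, f_1$ ($f_0+f_1=1$) are the limiting fractions of requests whose service is of type 0 and type 1 respectively. *)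

(* Defs.v *)
From HB Require Import structures.
From mathcomp Require Import all_boot all_order all_algebra.
From mathcomp Require Import all_classical all_reals all_analysis.
Set Implicit Arguments. Unset Strict Implicit. Unset Printing Implicit Defensive.
Import Order.TTheory GRing.Theory Num.Theory.
Import numFieldNormedType.Exports.
Local Open Scope classical_set_scope.
Local Open Scope ring_scope.

(* Sample-path dynamics of the FJ-FA system with availability one and        *)
(* locality two.  Servers: 0 = systematic server (stores a), 1 = server      *)
(* storing b, 2 = server storing a+b (the recovery group of a).              *)
(*   e n      : interarrival time before request n (request n arrives at    *)
(*              time  e 0 + ... + e n); Poisson arrivals <-> iid Exp(lambda)*)
(*   S s n    : service time of the (sub-)copy of request n at server s.    *)
(* All servers are FCFS and every request sends a (sub-)copy to each of the *)
(* three servers, so each server handles requests in index order.           *)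
Section Dynamics.
Variable R : realType.
Variables (e : nat -> R) (S : 'I_3 -> nat -> R).

Definition sys : 'I_3 := ord0.
Definition rec1 : 'I_3 := @Ordinal 3 1 isT.
Definition rec2 : 'I_3 := @Ordinal 3 2 isT.

Definition arrival (n : nat) : R := \sum_(k < n.+1) e k.

(* free_time n s : time at which server s is done (served or removed) with  *)
(* all the (sub-)copies of requests 0..n-1; servers are idle at time 0.     *)
Fixpoint free_time (n : nat) : 'I_3 -> R :=
  match n with
  | 0 => fun _ => 0
  | n'.+1 =>
      let f := free_time n' in
      let st s := Num.max (arrival n') (f s) in
      let C := Num.min (st sys + S sys n')
                 (Num.max (st rec1 + S rec1 n') (st rec2 + S rec2 n')) in
      fun s => Num.max (st s) (Num.min C (st s + S s n'))
  end.

(* time at which the (sub-)copy of request n starts service at server s     *)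
(* (if this is later than the completion of request n, the sub-copy was     *)
(* removed from the queue before starting and this value is irrelevant).    *)
Definition start (n : nat) (s : 'I_3) : R :=
  Num.max (arrival n) (free_time n s).

(* completion time of request n: its systematic copy finishes, or its       *)
(* recovery-group copy completes (both sub-copies finish).                   *)
Definition completion (n : nat) : R :=
  Num.min (start n sys + S sys n)
    (Num.max (start n rec1 + S rec1 n) (start n rec2 + S rec2 n)).

Definition departure (n : nat) (s : 'I_3) : R := free_time n.+1 s.

(* request n is at the head of the line at time t: it has arrived and all   *)
(* its (sub-)copies still in the system at time t are in service.            *)
Definition hol_at (n : nat) (t : R) : Prop :=
  arrival n <= t /\ forall s : 'I_3, t < departure n s -> start n s <= t.

(* type-1 service: one of the two recovery sub-copies had already finished  *)
(* service before the request reached the head of the line.                  *)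
Definition service_type1 (n : nat) : Prop :=
  exists s : 'I_3, [/\ s != sys,
    start n s + S s n <= completion n &
    forall t, t <= start n s + S s n -> ~ hol_at n t].

Definition service_type0 (n : nat) : Prop := ~ service_type1 n.

Definition fraction (Q : nat -> Prop) (N : nat) : R :=
  (\sum_(n < N) (if `[< Q n >] then 1 else 0)) / N%:R.

End Dynamics.
Arguments fraction {R} Q N.

Definition mutually_independent (R : realType) (d : measure_display)
    (T : measurableType d) (P : probability T R) (I : eqType)
    (X : I -> {RV P >-> R}) : Prop :=
  forall (J : seq I) (B : I -> set R), uniq J ->
    (forall i, measurable (B i)) ->
    P (\bigcap_(i in [set` J]) (X i @^-1` B i)) =
      (\prod_(i <- J) P (X i @^-1` B i))%E.

(* Main.v *)
(** At the moment a request reaches the head of the line, one recovery server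
    is level with the systematic one and the other is ahead by some time [L].
    Let [A] be the service time at the systematic server and [X1], [X2] the work
    left on the two recovery sub-copies, so that the service is of type 0 when
    both are positive.  Pathwise, for the service times [S1], [S2],
      [L' - L <= min A X1 + min A X2 - 2 min (A, X1, X2) + X1 - S1 + X2 - S2],
    with equality in a saturated system: arrivals can only shrink the lead.
    By the memoryless property each term on the right has tail [p exp (- k t)],
    where [p] is the probability that the residuals involved are positive, hence
    mean [p / k].  Since the lead starts at 0 and stays nonnegative, summing the
    expected drifts over [n < N] bounds [sum P (X1 > 0, X2 > 0)] below by [N]
    times the announced constant, and dominated convergence transfers this to
    the limiting fraction. *)

Require Import Defs.
From HB Require Import structures.
From mathcomp Require Import all_boot all_order all_algebra.
From mathcomp Require Import all_classical all_reals all_analysis.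
From mathcomp Require Import measurable_realfun ring lra.
Import Order.TTheory GRing.Theory Num.Theory.
Import numFieldNormedType.Exports.
Local Open Scope classical_set_scope.
Local Open Scope ring_scope.
Set Implicit Arguments.
Unset Strict Implicit.
Unset Printing Implicit Defensive.

(** * Pathwise drift of the lead over one request *)

Ltac no_minmax e :=
  lazymatch e with
  | context [Num.min _ _] => fail
  | context [Num.max _ _] => fail
  | _ => idtac
  end.

(** Only arguments free of [min] and [max] are compared, so innermost operations are split first and
    the hypotheses left behind are linear, as [lra] requires. *)
Ltac split_minmax :=
  match goal with
  | |- context [Num.min ?x ?y] => no_minmax x; no_minmax y; case: (leP x y) => ?
  | |- context [Num.max ?x ?y] => no_minmax x; no_minmax y; case: (leP x y) => ?
  end.

(** Truncation below at [b] is nondecreasing and 1-Lipschitz. With [b] an arrival time, waiting for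
    it never widens the gap between two servers. *)
Lemma max_sub_max_le (R : realType) (b x y : R) : y <= x ->
  Num.max b x - Num.max b y <= x - y.
Proof. by move=> ?; repeat split_minmax; lra. Qed.

(* One request: the recovery servers start it at [a1] and [a2], the systematic
   server at [h]; it completes at [c], and the three servers are then free at
   times [f], [f1] and [f2]. *)
Section OneRequest.
Context {R : realType}.
Variables (a1 a2 A S1 S2 : R).
Hypotheses (A0 : 0 <= A) (S10 : 0 <= S1) (S20 : 0 <= S2).

Let h := Num.max a1 a2.
Let c := Num.min (h + A) (Num.max (a1 + S1) (a2 + S2)).
Let f := Num.max h (Num.min c (h + A)).
Let f1 := Num.max a1 (Num.min c (a1 + S1)).
Let f2 := Num.max a2 (Num.min c (a2 + S2)).

Let hc : h <= c.
Proof.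
rewrite /c le_min lerDl A0/= /h ge_max !le_max lerDl S10/=.
by rewrite lerDl S20 orbT.
Qed.

Let fE : f = c.
Proof. by rewrite /f (min_idPl _) ?(max_idPr _)// /c ge_min lexx. Qed.

Let f1E : f1 = Num.min c (a1 + S1).
Proof.
by rewrite /f1 (max_idPr _)// le_min lerDl S10 andbT (le_trans _ hc)// le_max lexx.
Qed.

Let f2E : f2 = Num.min c (a2 + S2).
Proof.
by rewrite /f2 (max_idPr _)// le_min lerDl S20 andbT (le_trans _ hc)// le_max lexx orbT.
Qed.

(** As [c] is at most the later recovery finish time, capping that maximum at [c] gives back [c], at
    which the systematic server is freed. *)
Lemma recovery_catches_up : f = Num.max f1 f2.
Proof.
rewrite fE f1E f2E -min_maxr; apply/esym/min_idPl.
by rewrite ge_min lexx orbT.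
Qed.

(** Time is counted from [h]: [y2] is the work of the level recovery server, [y1] the signed work of
    the one ahead, negative if it finished before [h], and [d] is the time from [h] to
    completion. *)
Let lead_drift_aux (y1 y2 : R) : 0 <= y2 ->
  let d := Num.min A (Num.max y1 y2) in let X := Num.max 0 y1 in
  (d - Num.min d y1) + (d - Num.min d y2)
  + (Num.min A (Num.min X y2) + Num.min A (Num.min X y2))
  <= Num.min A X + Num.min A y2 + X - y1.
Proof.
move=> y20; cbv zeta; case: (leP 0 y1) => ?; case: (leP y1 y2) => ?.
- by case: (leP A y1) => ?; case: (leP A y2) => ?; repeat split_minmax; lra.
- by case: (leP A y1) => ?; case: (leP A y2) => ?; repeat split_minmax; lra.
(* Here [y1 < 0]: the residual [X] and the minima involving it are 0, while [min d y1] is [y1]. *)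
- rewrite (min_idPl y20) (min_idPr A0) (min_idPr (_ : y1 <= _)); last first.
    by rewrite le_min (le_trans _ A0) ?(le_trans _ y20)// ltW.
  by case: (leP A y2) => ?; repeat split_minmax; lra.
- by lra.
Qed.

(** Subtracted terms stand on the left, so that both sides can later be integrated as sums of
    nonnegative variables. *)
Lemma lead_drift :
  let X1 := Num.max 0 (S1 - Num.max 0 (h - a1)) in
  let X2 := Num.max 0 (S2 - Num.max 0 (h - a2)) in
  (f - f1) + (f - f2)
  + (Num.min A (Num.min X1 X2) + Num.min A (Num.min X1 X2) + S1 + S2)
  <= (h - a1) + (h - a2) + (Num.min A X1 + Num.min A X2 + X1 + X2).
Proof.
rewrite fE f1E f2E; cbv zeta.
have minDh (x y : R) : Num.min (h + x) y = h + Num.min x (y - h).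
  by rewrite [RHS]addr_minr (addrC h (y - h)) subrK.
have -> : c = h + Num.min A (Num.max (a1 + S1 - h) (a2 + S2 - h)).
  by rewrite /c minDh [Num.max _ _ - h]addr_maxl.
(* The server with the larger start time is level with [h]; the other one plays the role of [y1]. *)
rewrite !minDh; case: (leP a1 a2) => a12.
- have hE : h = a2 by rewrite /h (max_idPr _).
  have := @lead_drift_aux (a1 + S1 - h) (a2 + S2 - h).
  rewrite hE subrr maxxx subr0 (max_idPr (_ : 0 <= a2 - a1)); last first.
    by rewrite subr_ge0.
  have -> : S1 - (a2 - a1) = a1 + S1 - a2 by lra.
  have -> : a2 + S2 - a2 = S2 by lra.
  by rewrite (max_idPr S20) => /(_ S20); cbv zeta; lra.
- have hE : h = a1 by rewrite /h (max_idPl _)// ltW.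
  have := @lead_drift_aux (a2 + S2 - h) (a1 + S1 - h).
  rewrite hE subrr maxxx subr0 (max_idPr (_ : 0 <= a1 - a2)); last first.
    by rewrite subr_ge0 ltW.
  have -> : S2 - (a1 - a2) = a2 + S2 - a1 by lra.
  have -> : a1 + S1 - a1 = S1 by lra.
  rewrite (max_idPr S10) => /(_ S10); cbv zeta.
  rewrite (maxC S1) (minC S1); lra.
Qed.

End OneRequest.

(** * Exponential laws: tails and means *)

Lemma exponential_prob_itvoy (R : realType) (rate x : R) : 0 < rate -> 0 <= x ->
  exponential_prob rate `]x, +oo[ = (expR (- rate * x))%:E.
Proof.
move=> rate0 x0.
have cexp : continuous (fun z : R^o => expR (- rate * z)).
  move=> z; apply: continuous_comp; last exact: continuous_expR.
  by apply: continuousM => //; exact: cst_continuous.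
rewrite /exponential_prob integral_itv_obnd_cbnd; last first.
  by apply/measurable_EFinP/measurable_funTS; exact: measurable_exponential_pdf.
rewrite (@ge0_continuous_FTC2y _ _ (fun y => - (expR (- rate * y))) _ 0)//.
- by rewrite EFinN oppeK add0e.
- by move=> y _; apply: exponential_pdf_ge0; exact: ltW.
- apply: (@continuous_subspaceW R^o _ _ [set` `[0, +oo[%R]).
    by apply: subset_itvr; rewrite bnd_simp.
  exact: within_continuous_exponential_pdf.
- rewrite -oppr0; apply: cvgN.
  rewrite (_ : (fun y => expR (- rate * y)) =
               (fun z => expR (- z)) \o (fun z => rate * z)); last first.
    by apply: eq_fun => y; rewrite mulNr.
  apply: (@cvg_comp _ _ _ _ _ _ (pinfty_nbhs R)); last exact: cvgr_expR.
  exact: gt0_cvgMry.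
- by apply: cvgN; apply/cvg_at_right_filter; exact: cexp.
- move=> y; rewrite in_itv/= andbT => xy; apply: derive1_exponential_pdf.
  by rewrite in_itv/= andbT (le_lt_trans x0).
Qed.

(** The exponential density has total mass 1; divide by [rate]. *)
Lemma integral_expR_itv0y (R : realType) (rate : R) : 0 < rate ->
  (\int[lebesgue_measure]_(t in `[0%R, +oo[) (expR (- rate * t))%:E
   = (rate^-1)%:E)%E.
Proof.
move=> rate0; have := exponential_prob_itvoy rate0 (lexx 0).
rewrite /exponential_prob integral_itv_obnd_cbnd; last first.
  by apply/measurable_EFinP/measurable_funTS; exact: measurable_exponential_pdf.
under eq_integral => y.
  rewrite inE/= in_itv/= andbT => y0; rewrite exponential_pdfE// EFinM; over.
rewrite ge0_integralZl//=; last 2 first.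
- by apply/measurable_EFinP/measurable_funTS/measurableT_comp => //;
    exact: measurable_funM.
- by rewrite lee_fin ltW.
rewrite mulr0 expR0 => H; rewrite -[RHS]mule1 -H muleA -EFinM mulVf ?gt_eqF//.
by rewrite mul1e.
Qed.

(* The means below are all finite, so they are recorded as real numbers. *)
Definition has_mean (R : realType) (d : measure_display) (T : measurableType d)
    (P : {measure set T -> \bar R}) (Y : T -> R) (v : R) :=
  [/\ forall w, 0 <= Y w, measurable_fun setT Y &
      (\int[P]_w (Y w)%:E = v%:E)%E].

Section HasMean.
Context {R : realType} {d : measure_display} {T : measurableType d}
  (P : {measure set T -> \bar R}).

Lemma has_meanD Y Z u v : has_mean P Y u -> has_mean P Z v ->
  has_mean P (fun w => Y w + Z w) (u + v).
Proof.
move=> [Y0 mY EY] [Z0 mZ EZ]; split.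
- by move=> w; exact: addr_ge0.
- exact: measurable_funD.
move/measurable_EFinP : mY => mY; move/measurable_EFinP : mZ => mZ.
transitivity (\int[P]_w (Y w)%:E + \int[P]_w (Z w)%:E)%E; last by rewrite EY EZ.
under eq_integral do rewrite EFinD.
by apply: ge0_integralD => // w _; rewrite lee_fin.
Qed.

Lemma has_mean_sum (Y : nat -> T -> R) (v : nat -> R) N :
  (forall n, has_mean P (Y n) (v n)) ->
  has_mean P (fun w => \sum_(n < N) Y n w) (\sum_(n < N) v n).
Proof.
move=> Yv; elim: N => [|N IHN].
  rewrite big_ord0 (_ : (fun=> _) = cst 0).
    by split => //; rewrite integral0_eq.
  by apply/funext => w; rewrite big_ord0.
rewrite big_ord_recr (_ : (fun=> _) = (fun w => \sum_(n < N) Y n w + Y N w)).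
  exact: has_meanD.
by apply/funext => w; rewrite big_ord_recr.
Qed.

Lemma ae_has_mean_le Y Z u v : has_mean P Y u -> has_mean P Z v ->
  {ae P, forall w, Y w <= Z w} -> u <= v.
Proof.
move=> [Y0 mY EY] [Z0 mZ EZ] YZ; rewrite -lee_fin -EY -EZ.
apply: ae_ge0_le_integral => //.
- by move=> w _; rewrite lee_fin.
- exact/measurable_EFinP.
- by move=> w _; rewrite lee_fin.
- exact/measurable_EFinP.
- by apply: filterS YZ => w YZw _; rewrite lee_fin.
Qed.

End HasMean.

(* Integrate the tail: E Y = \int_0^oo P (Y > t) dt. *)
Lemma has_mean_exp_tail (R : realType) (d : measure_display)
    (T : measurableType d) (P : probability T R) (Y : T -> R) (p rate : R) :
  measurable_fun setT Y -> (forall w, 0 <= Y w) -> 0 < rate -> 0 <= p ->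
  (forall t, 0 <= t -> P [set w | t < Y w] = (p * expR (- rate * t))%:E) ->
  has_mean P Y (p / rate).
Proof.
move=> mY Y0 rate0 p0 tailY; split => //.
pose Z : {RV P >-> R} := mfun_Sub (mem_set mY : Y \in mfun).
have := @ge0_expectation_ccdf _ _ _ P Z Y0; rewrite unlock /= => ->.
rewrite (_ : (\int[_]_(_ in _) _)%E =
    (\int[lebesgue_measure]_(t in `[0%R, +oo[)
      (p%:E * (expR (- rate * t))%:E))%E); last first.
  apply: eq_integral => t; rewrite inE/= in_itv/= andbT => t0.
  rewrite -EFinM -tailY// /ccdf /distribution /pushforward/=; congr (P _).
  by apply/seteqP; split => w /=; rewrite in_itv/= andbT.
rewrite ge0_integralZl//=.
- by rewrite integral_expR_itv0y// EFinM.
- by apply/measurable_EFinP/measurable_funTS/measurableT_comp => //;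
    exact: measurable_funM.
Qed.

Lemma measurable_set_ltr (R : realType) (d : measure_display)
    (T : measurableType d) (f g : T -> R) :
  measurable_fun setT f -> measurable_fun setT g ->
  measurable [set x | f x < g x].
Proof.
move=> mf mg; have := @measurable_fun_ltr _ _ _ _ _ _ mf mg.
by move=> /(_ measurableT [set true]); rewrite setTI; exact.
Qed.

(** * Independence of one coordinate from the others, and memorylessness *)

Section Independence.
Context {R : realType} {d : measure_display} {T : measurableType d}
  (P : probability T R) {I : eqType} (V : I -> {RV P >-> R}) (i0 : I).
Hypothesis indepV : mutually_independent V.

(** A pi-system generating the events determined by the variables other than [V i0]. *)
Definition cylinders_off : set (set T) :=
  [set E | exists J : seq I, exists B : I -> set R,
    [/\ uniq J, i0 \notin J, forall i, measurable (B i) &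
        E = \bigcap_(i in [set` J]) (V i @^-1` B i)]].

Lemma cylinders_off_measurable : cylinders_off `<=` measurable.
Proof.
move=> _ [J [B [_ _ mB ->]]]; apply: fin_bigcap_measurable => // i _.
by rewrite -[X in measurable X]setTI; exact: measurable_funP.
Qed.

Lemma setI_closed_cylinders_off : setI_closed cylinders_off.
Proof.
move=> _ _ [J [B [uJ i0J mB ->]]] [K [C [uK i0K mC ->]]].
(* An index occurring in one list only gets [setT] from the other. *)
exists (undup (J ++ K)), (fun i => (if i \in J then B i else setT) `&`
  (if i \in K then C i else setT)); split.
- exact: undup_uniq.
- by rewrite mem_undup mem_cat negb_or i0J.
- by move=> i; apply: measurableI; case: ifP.
- apply/seteqP; split => [w [wJ wK] i /=|w /= wJK].
    rewrite mem_undup mem_cat => _; split; case: ifPn => // ?.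
      exact: wJ.
    exact: wK.
  split => i /= iJ; have /= := wJK i; rewrite mem_undup mem_cat iJ ?orbT => /(_ isT).
    by case.
  by case.
Qed.

Let cylinders_offT : cylinders_off setT.
Proof.
exists [::], (fun=> setT); split => //.
by apply/seteqP; split => // w _ i.
Qed.

Lemma cylinders_off_preimage i : i != i0 ->
  measurable_fun [set: g_sigma_algebraType cylinders_off] (V i).
Proof.
move=> ii0 _ B mB; rewrite setTI; apply: sub_sigma_algebra.
exists [:: i], (fun=> B); split => //; first by rewrite inE eq_sym.
apply/seteqP; split => [w wB j /=|w /(_ i)/=]; last by rewrite inE eqxx; exact.
by rewrite inE => /eqP ->.
Qed.

Lemma sigma_cylinders_off_sub : <<s cylinders_off >> `<=` measurable.
Proof.
exact: smallest_sub (@sigma_algebra_measurable _ T) cylinders_off_measurable.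
Qed.

(** Both sides are finite measures in [E]. They agree on the pi-system by independence over the list
    [i0 :: J], hence on the sigma-algebra it generates. *)
Lemma indep_sigma_off (E : set T) (C : set R) :
  <<s cylinders_off >> E -> measurable C ->
  P (E `&` V i0 @^-1` C) = (P E * P (V i0 @^-1` C))%E.
Proof.
move=> sE mC.
have mVC : measurable (V i0 @^-1` C).
  by rewrite -[X in measurable X]setTI; exact: measurable_funP.
have p0 : 0 <= fine (P (V i0 @^-1` C)) by rewrite fine_ge0.
pose m2 := mscale (NngNum p0) P.
have PE : mrestr P mVC E = m2 E.
  apply: (@g_sigma_algebra_measure_unique _ R T cylinders_off _ (fun=> setT)) => //.
  - exact: cylinders_off_measurable.
  - by rewrite bigcup_const.
  - exact: setI_closed_cylinders_off.
  - move=> _ [J [B [uJ i0J mB ->]]].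
    pose F := \bigcap_(i in [set` J]) V i @^-1` B i.
    suff : (P (F `&` V i0 @^-1` C) = (fine (P (V i0 @^-1` C)))%:E * P F)%E by [].
    rewrite (fineK (fin_num_measure P _ mVC)) /F.
    pose B' i := if i == i0 then C else B i.
    have eqB : {in J, forall i, B' i = B i}.
      by move=> i iJ; rewrite /B'; case: eqP => // ii0; rewrite -ii0 iJ in i0J.
    have mB' i : measurable (B' i) by rewrite /B'; case: ifP.
    rewrite (indepV uJ mB).
    have -> : (\prod_(j <- J) P (V j @^-1` B j) =
               \prod_(j <- J) P (V j @^-1` B' j))%E.
      by apply: eq_big_seq => i iJ; rewrite eqB.
    have uiJ : uniq (i0 :: J) by rewrite /= i0J.
    have B'0 : B' i0 = C by rewrite /B' eqxx.
    have := indepV uiJ mB'; rewrite big_cons B'0 => <-; congr (P _).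
    apply/seteqP; split => [w [wJ wC] i /=|w wJ].
      by rewrite inE /B'; case: eqP => [->//|_ /= iJ]; exact: wJ.
    split => [i /= iJ|].
      by have := wJ i; rewrite /= inE iJ orbT eqB//; exact.
    by have := wJ i0; rewrite /= inE eqxx /B' eqxx; exact.
  - by move=> _; rewrite /= /mrestr setTI (le_lt_trans (probability_le1 _ _)) ?ltry.
rewrite muleC -(fineK (fin_num_measure P _ mVC)); exact: PE.
Qed.

Let Toff := g_sigma_algebraType cylinders_off.

(** The identity into the coarser space is one random variable carrying all coordinates but [V i0];
    its joint law with [V i0] is a product. *)
Lemma measurable_fun_id_off : measurable_fun [set: T] (id : T -> Toff).
Proof. by move=> _ E sE; rewrite setTI; exact: sigma_cylinders_off_sub. Qed.

Variable rate : R.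
Hypothesis rate0 : 0 < rate.
Hypothesis distr0 : forall C, measurable C ->
  distribution P (V i0) C = exponential_prob rate C.

(** Integrating [V i0] out first, the event with shift [s] has probability [expR (- rate * s)] times
    the integral of [expR (- rate * U)] over [G]. The latter does not depend on [s]; compare [s = t]
    with [s = 0]. *)
Lemma memoryless_off (G : set T) (U : T -> R) (t : R) :
  <<s cylinders_off >> G -> measurable_fun [set: Toff] U ->
  (forall w, 0 <= U w) -> 0 <= t ->
  P (G `&` [set w | U w + t < V i0 w]) =
  ((expR (- rate * t))%:E * P (G `&` [set w | (U w < V i0 w)%R]))%E.
Proof.
move=> sG mU U0.
have mid := measurable_fun_id_off.
pose idm : {mfun T >-> Toff} := mfun_Sub (mem_set mid : (id : T -> Toff) \in mfun).
have mpair : measurable_fun [set: T] (fun w => (w : Toff, V i0 w)).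
  exact: measurable_fun_pair.
pose prm : {mfun T >-> (Toff * R)%type} :=
  @mfun_Sub _ _ T (Toff * R)%type _ (mem_set mpair).
pose g (w : Toff) : \bar R := (\1_G w * expR (- rate * U w))%:E.
have mg : measurable_fun [set: Toff] g.
  apply/measurable_EFinP; apply: measurable_funM; first exact: measurable_indic.
  by apply: measurableT_comp => //; exact: measurable_funM.
have tail s : 0 <= s -> P (G `&` [set w | U w + s < V i0 w]) =
    ((expR (- rate * s))%:E * \int[distribution P idm]_w g w)%E.
  move=> s0.
  pose X : set (Toff * R) := [set p | G p.1 /\ U p.1 + s < p.2].
  have mX : measurable X.
    rewrite (_ : X = (fst @^-1` G) `&` [set p | U p.1 + s < p.2]); last by [].
    apply: measurableI.
      by rewrite -[X in measurable X]setTI; exact: measurable_fst.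
    apply: measurable_set_ltr => //.
    by apply: measurable_funD => //; exact: (measurableT_comp mU measurable_fst).
  have PX := @product_measure_unique _ _ Toff R R (distribution P idm)
    (distribution P (V i0)) (distribution P prm) _ X mX.
  transitivity ((distribution P idm \x distribution P (V i0))%E X).
    rewrite PX// => A B mA mB; rewrite /distribution /pushforward /=.
    exact: indep_sigma_off.
  rewrite -ge0_integralZl//=; last by move=> w _; rewrite lee_fin mulr_ge0 ?expR_ge0.
  apply: eq_integral => w _; rewrite /g /=.
  have [Gw|nGw] := pselect (G w).
    have -> : xsection X w = `]U w + s, +oo[%classic.
      apply/seteqP; split => y /=; rewrite /xsection/= inE /X/= in_itv/= andbT.
        by case.
      by split.
    rewrite distr0// exponential_prob_itvoy ?addr_ge0//.
    by rewrite indicE mem_set// mul1r -EFinM -expRD -mulrDr addrC.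
  have -> : xsection X w = set0.
    by apply/seteqP; split => y //=; rewrite /xsection/= inE /X/= => -[].
  by rewrite measure0 indicE memNset// mul0r mule0.
move=> t0; rewrite tail//; congr (_ * _)%E.
have := tail 0 (lexx 0); rewrite mulr0 expR0 mul1e => <-.
by congr (P (_ `&` _)); apply/seteqP; split => w /=; rewrite addr0.
Qed.

End Independence.

(** * Sample paths: leads, residuals and the summed drift *)

Lemma server_ind (Q : 'I_3 -> Prop) :
  Q sys -> Q rec1 -> Q rec2 -> forall s, Q s.
Proof.
move=> Q0 Q1 Q2 [[|[|[|//]]] i3].
- by rewrite (_ : Ordinal i3 = sys)//; exact: val_inj.
- by rewrite (_ : Ordinal i3 = rec1)//; exact: val_inj.
- by rewrite (_ : Ordinal i3 = rec2)//; exact: val_inj.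
Qed.

Lemma max_maxDr (R : realType) (a x y : R) :
  Num.max a (Num.max x y) = Num.max (Num.max a x) (Num.max a y).
Proof. by rewrite -{1}[a]maxxx maxACA. Qed.

Section SamplePath.
Context {R : realType} (e : nat -> R) (S : 'I_3 -> nat -> R).

(* The truncation at 0 is only effective on the null event that some service
   time is negative. *)
Definition lead (n : nat) (s : 'I_3) : R :=
  Num.max 0 (start e S n sys - start e S n s).

(* Work left on the sub-copy of request [n] at server [s] when the request
   reaches the head of the line. *)
Definition residual (n : nat) (s : 'I_3) : R := Num.max 0 (S s n - lead n s).

Lemma lead_ge0 n s : 0 <= lead n s.
Proof. by rewrite le_max lexx. Qed.

Lemma residual_ge0 n s : 0 <= residual n s.
Proof. by rewrite le_max lexx. Qed.

Lemma residual_gt n s t : 0 <= t ->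
  (t < residual n s) = (lead n s + t < S s n).
Proof. by move=> t0; rewrite lt_max ltNge t0/= ltrBrDl. Qed.

Hypothesis S0 : forall s n, 0 <= S s n.

(** The invariant of the dynamics: it holds at time 0, and each request preserves it by
    [recovery_catches_up]. *)
Lemma free_time_sys n : free_time e S n sys =
  Num.max (free_time e S n rec1) (free_time e S n rec2).
Proof.
elim: n => [|n IHn]; first by rewrite /= maxxx.
rewrite /= IHn max_maxDr.
exact: recovery_catches_up.
Qed.

Lemma free_time_le_sys n s : free_time e S n s <= free_time e S n sys.
Proof.
elim/server_ind: s => //; rewrite free_time_sys.
- by rewrite le_max lexx.
- by rewrite le_max [X in _ || X]lexx orbT.
Qed.

Lemma start_sys n : start e S n sys =
  Num.max (start e S n rec1) (start e S n rec2).
Proof. by rewrite /start free_time_sys max_maxDr. Qed.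

Lemma start_le_sys n s : start e S n s <= start e S n sys.
Proof. by rewrite /start ge_max !le_max lexx free_time_le_sys orbT. Qed.

Lemma leadE n s : lead n s = start e S n sys - start e S n s.
Proof. by apply/max_idPr; rewrite subr_ge0 start_le_sys. Qed.

(** [lead_drift] bounds the gaps between free times after request [n]; waiting for the next arrival
    can only shrink them. *)
Lemma lead_recurrence n :
  lead n.+1 rec1 + lead n.+1 rec2
  + (Num.min (S sys n) (Num.min (residual n rec1) (residual n rec2))
     + Num.min (S sys n) (Num.min (residual n rec1) (residual n rec2))
     + S rec1 n + S rec2 n)
  <= lead n rec1 + lead n rec2
  + (Num.min (S sys n) (residual n rec1) + Num.min (S sys n) (residual n rec2)
     + residual n rec1 + residual n rec2).
Proof.
have := @lead_drift _ (start e S n rec1) (start e S n rec2) _ _ _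
  (S0 sys n) (S0 rec1 n) (S0 rec2 n).
rewrite /= -start_sys -/(lead n rec1) -/(lead n rec2).
rewrite -/(residual n rec1) -/(residual n rec2) -!leadE.
apply: le_trans; rewrite lerD2r.
have leads s : lead n.+1 s <= free_time e S n.+1 sys - free_time e S n.+1 s.
  by rewrite leadE; apply: max_sub_max_le; exact: free_time_le_sys.
exact: lerD (leads rec1) (leads rec2).
Qed.

(** The recurrence telescopes from a zero lead, and the final lead is nonnegative. *)
Lemma drift_balance N :
  \sum_(n < N) (Num.min (S sys n) (Num.min (residual n rec1) (residual n rec2))
     + Num.min (S sys n) (Num.min (residual n rec1) (residual n rec2))
     + S rec1 n + S rec2 n)
  <= \sum_(n < N) (Num.min (S sys n) (residual n rec1)
     + Num.min (S sys n) (residual n rec2)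
     + residual n rec1 + residual n rec2).
Proof.
suff : lead N rec1 + lead N rec2 + \sum_(n < N)
    (Num.min (S sys n) (Num.min (residual n rec1) (residual n rec2))
     + Num.min (S sys n) (Num.min (residual n rec1) (residual n rec2))
     + S rec1 n + S rec2 n)
  <= \sum_(n < N) (Num.min (S sys n) (residual n rec1)
     + Num.min (S sys n) (residual n rec2)
     + residual n rec1 + residual n rec2).
  by apply: le_trans; rewrite lerDr addr_ge0 ?lead_ge0.
elim: N => [|N IHN]; first by rewrite !big_ord0 !leadE /start /= subrr !addr0.
rewrite !big_ord_recr/=.
have := lead_recurrence N; move: IHN.
set a := \sum_(n < N) _; set b := \sum_(n < N) _.
by move: a b => a b; lra.
Qed.

(** By [start e S n sys] every copy still present is in service, so the request is at the head of
    the line while both recovery sub-copies still have work left. *)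
Lemma service_type0_lead n :
  lead n rec1 < S rec1 n -> lead n rec2 < S rec2 n -> service_type0 e S n.
Proof.
move=> l1 l2 [s [ssys _ nhol]].
apply: (nhol (start e S n sys)); last first.
  by split => [|s' _]; [rewrite /start le_max lexx|exact: start_le_sys].
suff /ltW : lead n s < S s n by rewrite leadE lerBlDl.
by elim/server_ind: s ssys {nhol}.
Qed.

End SamplePath.

(** * Measurability and causality of the dynamics *)

Section DynamicsMeasurability.
Context {R : realType} {d : measure_display} {T : measurableType d}.
Variables (e : T -> nat -> R) (S : T -> 'I_3 -> nat -> R).

Lemma measurable_arrival n :
  (forall k, (k <= n)%N -> measurable_fun setT (e ^~ k)) ->
  measurable_fun setT (fun w => arrival (e w) n).
Proof.
move=> me; apply: measurable_sum => k; apply: me.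
by rewrite -ltnS.
Qed.

Lemma measurable_free_time n :
  (forall k, (k < n)%N -> measurable_fun setT (e ^~ k)) ->
  (forall k s, (k < n)%N -> measurable_fun setT (fun w => S w s k)) ->
  forall s, measurable_fun setT (fun w => free_time (e w) (S w) n s).
Proof.
elim: n => [|n IHn] me mS s; first exact: measurable_cst.
have mst s' : measurable_fun setT
    (fun w => Num.max (arrival (e w) n) (free_time (e w) (S w) n s')).
  apply: measurable_maxr; first by apply: measurable_arrival => k kn; exact: me.
  by apply: IHn => k => [kn|s'' kn]; [apply: me|apply: mS]; rewrite ltnW.
have mD s' : measurable_fun setT
    (fun w => Num.max (arrival (e w) n) (free_time (e w) (S w) n s') + S w s' n).
  by apply: measurable_funD => //; exact: mS.
by rewrite /=; apply: measurable_maxr => //; do ?apply: measurable_minr => //;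
   apply: measurable_maxr.
Qed.

(** The bounds on [k] express causality: services of request [n] itself do not enter its lead. The
    sigma-algebra is left general so that it can be the one generated by the other coordinates. *)
Lemma measurable_lead n s :
  (forall k, (k <= n)%N -> measurable_fun setT (e ^~ k)) ->
  (forall k s, (k < n)%N -> measurable_fun setT (fun w => S w s k)) ->
  measurable_fun setT (fun w => lead (e w) (S w) n s).
Proof.
move=> me mS.
have mst s' : measurable_fun setT (fun w => start (e w) (S w) n s').
  apply: measurable_maxr; first exact: measurable_arrival.
  by apply: measurable_free_time => // k kn; apply: me; exact: ltnW.
by apply: measurable_maxr => //; exact: measurable_funB.
Qed.

End DynamicsMeasurability.

(** * From bounds on probabilities to the almost sure limit *)

(** [F] may fail to be measurable, so dominated convergence is applied to [max (g N) f]. It lies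
    almost surely between [f] and [f + |F N - f|], is bounded by [1 + |f|], and its mean dominates
    that of [g N], which is at least [b] for [N > 0]. *)
Lemma cesaro_indic_le_ae_limit (R : realType) (d : measure_display)
    (T : measurableType d) (P : probability T R)
    (Q : nat -> set T) (F : T -> nat -> R) (b f : R) :
  (forall n, measurable (Q n)) ->
  {ae P, forall w, forall N, (\sum_(n < N) \1_(Q n) w) / N%:R <= F w N} ->
  {ae P, forall w, F w @ \oo --> f} ->
  (forall N, N%:R * b <= \sum_(n < N) fine (P (Q n))) ->
  b <= f.
Proof.
move=> mQ leF cvgF bP.
pose g N w : R := (\sum_(n < N) \1_(Q n) w) / N%:R.
pose h N w : R := Num.max (g N w) f.
have mg N : measurable_fun setT (g N).
  apply: measurable_funM => //; apply: measurable_sum => n.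
  exact: measurable_indic.
have mh N : measurable_fun setT (h N) by exact: measurable_maxr.
have g0 N w : 0 <= g N w by rewrite divr_ge0// sumr_ge0.
have g1 N w : g N w <= 1.
  (* For [N = 0] the quotient is 0 by the convention on inverses. *)
  case: N => [|N]; first by rewrite /g invr0 mulr0.
  rewrite ler_pdivrMr ?ltr0n// mul1r.
  have -> : N.+1%:R = \sum_(n < N.+1) 1 :> R by rewrite sumr_const card_ord.
  by apply: ler_sum => i _; rewrite indicE; case: (_ \in _).
have h_cvg : {ae P, forall w, setT w -> (h N w)%:E @[N --> \oo] --> f%:E}.
  near=> w => _.
  have leFw : forall N, g N w <= F w N by near: w.
  have cvgFw : F w @ \oo --> f by near: w.
  apply: cvg_EFin; first by near=> N.
  apply: (@squeeze_cvgr _ _ _ _ (fun N => f) (fun N => f + `|F w N - f|)).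
  - near=> N; rewrite /h le_max lexx orbT/= ge_max lerDl normr_ge0 andbT.
    by rewrite (le_trans (leFw N))// -lerBlDl ler_norm.
  - exact: cvg_cst.
  - rewrite -[X in _ --> X]addr0; apply: cvgD; first exact: cvg_cst.
    rewrite -(normr0 R) -(subrr f); apply: cvg_norm.
    by apply: cvgB => //; exact: cvg_cst.
pose M : R := 1 + `|f|.
have ig : P.-integrable setT (cst M%:E) by exact: finite_measure_integrable_cst.
have [] := @dominated_convergence _ _ _ P setT measurableT
  (fun N w => (h N w)%:E) (cst f%:E) (cst M%:E) _ _ h_cvg ig _.
- by move=> N; apply/measurable_EFinP.
- exact: measurable_cst.
- apply: aeW => w N _ /=; rewrite lee_fin /h /M ler_norml; apply/andP; split.
    rewrite le_max; apply/orP; left; apply: le_trans (g0 N w).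
    by rewrite oppr_le0 addr_ge0.
  rewrite ge_max (le_trans (g1 N w)) ?lerDl//=.
  by rewrite (le_trans (ler_norm _)) ?lerDr.
move=> _ _; rewrite (_ : (\int[_]_(_ in _) cst _ _)%E = f%:E); last first.
  by rewrite integral_cst// [X in (_ * X)%E](probability_setT P) mule1.
move=> lim_h.
rewrite -lee_fin -(cvg_lim _ lim_h)//.
apply: lime_ge; first by apply/cvg_ex; exists f%:E.
near=> N.
have N0 : 0 < N%:R :> R by rewrite ltr0n; near: N; exact: nbhs_infty_gt.
apply: (@le_trans _ _ (\int[P]_w (g N w)%:E)%E); last first.
  apply: ge0_le_integral => //.
  - by move=> w _; rewrite lee_fin.
  - exact/measurable_EFinP.
  - exact/measurable_EFinP.
  - by move=> w _; rewrite lee_fin le_max lexx.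
have -> : (\int[P]_w (g N w)%:E = ((\sum_(n < N) fine (P (Q n))) / N%:R)%:E)%E.
  rewrite /g; under eq_integral do rewrite mulrC EFinM -sumEFin.
  rewrite ge0_integralZl//=; last 2 first.
  - apply: emeasurable_sum => n; apply/measurable_EFinP; exact: measurable_indic.
  - by move=> w _; apply: sume_ge0 => n _; rewrite lee_fin.
  rewrite ge0_integral_sum//; last first.
  - by move=> n; apply/measurable_EFinP; exact: measurable_indic.
  rewrite mulrC EFinM -sumEFin; congr (_ * _)%E; apply: eq_bigr => n _.
  by rewrite integral_indic// setIT fineK// fin_num_measure.
by rewrite lee_fin ler_pdivlMr// mulrC.
Unshelve. all: by end_near.
Qed.

(** * Means of the drift terms and the bound for type 0 *)

Section Expectations.
Context {R : realType} {d : measure_display} {T : measurableType d}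
  (P : probability T R) (V : nat * 'I_4 -> {RV P >-> R}) (gamma mu : R).
Hypotheses (gamma0 : 0 < gamma) (mu0 : 0 < mu).
Hypothesis indepV : mutually_independent V.

Let rate (s : 'I_3) := if s == sys then gamma else mu.

Hypothesis distrV : forall n s A, measurable A ->
  distribution P (V (n, lift ord0 s)) A = exponential_prob (rate s) A.

Let e w n := V (n, ord0) w.
Let S w (s : 'I_3) n := V (n, lift ord0 s) w.
Let off (n : nat) (s : 'I_3) := cylinders_off V (n, lift ord0 s).
Let X n s w := residual (e w) (S w) n s.
(** Truncation gives nonnegativity everywhere and alters the service time on a null event only. *)
Let A n w : R := Num.max 0 (S w sys n).
Let unfinished n s t := [set w | lead (e w) (S w) n s + t < S w s n].

Let rate0 s : 0 < rate s.
Proof. by rewrite /rate; case: ifP. Qed.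

Let mlead_off (n : nat) (s s' : 'I_3) : measurable_fun
  [set: g_sigma_algebraType (off n s)] (fun w => lead (e w) (S w) n s').
Proof.
apply: measurable_lead => [k _|k s'' kn]; apply: cylinders_off_preimage.
  by rewrite xpair_eqE negb_and orbC -val_eqE.
by rewrite xpair_eqE negb_and (ltn_eqF kn).
Qed.

Let mS_off (n : nat) (s s' : 'I_3) : s' != s ->
  measurable_fun [set: g_sigma_algebraType (off n s)] (fun w => S w s' n).
Proof.
move=> s's; apply: cylinders_off_preimage.
by rewrite xpair_eqE eqxx (inj_eq lift_inj).
Qed.

(** This lets the servers be integrated out one at a time. *)
Let unfinished_off (n : nat) (s s' : 'I_3) (t : R) : s' != s ->
  <<s off n s >> (unfinished n s' t).
Proof.
move=> s's.
apply: (@measurable_set_ltr _ _ (g_sigma_algebraType (off n s))).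
  by apply: measurable_funD => //; exact: measurable_cst.
exact: mS_off.
Qed.

Let munfinished n s t : measurable (unfinished n s t).
Proof.
apply: measurable_set_ltr => //; apply: measurable_funD => //.
exact: measurable_lead.
Qed.

Let offT n s : <<s off n s >> setT.
Proof. exact: (@measurableT _ (g_sigma_algebraType (off n s))). Qed.

Let unfinished_tail n s G (t : R) : <<s off n s >> G -> 0 <= t ->
  P (G `&` unfinished n s t) =
  ((expR (- rate s * t))%:E * P (G `&` unfinished n s 0))%E.
Proof.
move=> sG t0; rewrite /unfinished.
rewrite (memoryless_off indepV (rate0 s) (@distrV n s) sG (@mlead_off n s s))//.
  congr (_ * P (_ `&` _))%E.
  by apply/seteqP; split => w /=; rewrite addr0.
by move=> w; exact: lead_ge0.
Qed.

Let service_tail n s G (t : R) : <<s off n s >> G -> 0 <= t ->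
  P (G `&` [set w | t < S w s n]) = ((expR (- rate s * t))%:E * P G)%E.
Proof.
move=> sG t0.
have := @indep_sigma_off _ _ _ P _ V (n, lift ord0 s) indepV _ `]t, +oo[%classic sG.
rewrite -[P (V _ @^-1` _)]/(distribution P (V (n, lift ord0 s)) _).
rewrite distrV// exponential_prob_itvoy// muleC => <-//.
by congr (P (_ `&` _)); apply/seteqP; split => w /=; rewrite in_itv/= andbT.
Qed.

Let p n s := fine (P (unfinished n s 0)).
(** On this event service is almost surely of type 0. *)
Let q n := fine (P (unfinished n rec1 0 `&` unfinished n rec2 0)).

Let mX n s : measurable_fun setT (X n s).
Proof.
apply: measurable_maxr => //; apply: measurable_funB => //.
exact: measurable_lead.
Qed.

Let mA n : measurable_fun setT (A n).
Proof. exact: measurable_maxr. Qed.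

Let X0 n s w : 0 <= X n s w. Proof. exact: residual_ge0. Qed.

Let A0 n w : 0 <= A n w. Proof. by rewrite le_max lexx. Qed.

Lemma mean_service n s :
  has_mean P (fun w => Num.max 0 (S w s n)) (rate s)^-1.
Proof.
rewrite -div1r; apply: has_mean_exp_tail => //.
- exact: measurable_maxr.
- by move=> w; rewrite le_max lexx.
- move=> t t0; have := service_tail (@offT n s) t0.
  rewrite setTI probability_setT mule1 mul1r => <-; congr (P _).
  by apply/seteqP; split => w /=; rewrite lt_max ltNge t0.
Qed.

Lemma mean_residual n s :
  has_mean P (X n s) (p n s / rate s).
Proof.
apply: has_mean_exp_tail => //; first by rewrite fine_ge0.
move=> t t0; have := unfinished_tail (@offT n s) t0.
rewrite !setTI [p n s * _]mulrC EFinM fineK ?fin_num_measure// => <-; congr (P _).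
by apply/seteqP; split => w /=; rewrite residual_gt.
Qed.

(** A minimum exceeds [t] when both terms do; the two exponential factors multiply, so the rates
    add. *)
Lemma mean_min_residual n s : s != sys ->
  has_mean P (fun w => Num.min (A n w) (X n s w)) (p n s / (gamma + mu)).
Proof.
move=> ssys; apply: has_mean_exp_tail => //.
- exact: measurable_minr.
- by move=> w; rewrite le_min A0 X0.
- by rewrite addr_gt0.
- by rewrite fine_ge0.
move=> t t0.
transitivity (P (unfinished n s t `&` [set w | t < S w sys n])).
  congr (P _); apply/seteqP; split => w /=;
    rewrite lt_min residual_gt// lt_max ltNge t0/=.
    by case/andP.
  by case=> -> ->.
rewrite service_tail//; last exact: unfinished_off.
have := unfinished_tail (@offT n s) t0; rewrite !setTI => ->.
rewrite /rate eqxx (negbTE ssys) muleA -EFinM -expRD -mulrDl -opprD.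
by rewrite -[P _]fineK ?fin_num_measure// -EFinM mulrC.
Qed.

(** Strip the systematic server, then [rec2], then [rec1], the remaining events lying each time in
    the [off] sigma-algebra; the rates add up to [gamma + 2 * mu]. *)
Lemma mean_min_residuals n :
  has_mean P (fun w => Num.min (A n w) (Num.min (X n rec1 w) (X n rec2 w)))
    (q n / (gamma + 2 * mu)).
Proof.
apply: has_mean_exp_tail => //.
- by apply: measurable_minr => //; exact: measurable_minr.
- by move=> w; rewrite !le_min A0 !X0.
- by rewrite addr_gt0// mulr_gt0.
- by rewrite fine_ge0.
move=> t t0.
transitivity (P ((unfinished n rec1 t `&` unfinished n rec2 t)
    `&` [set w | t < S w sys n])).
  congr (P _); apply/seteqP; split => w /=;
    rewrite !lt_min !residual_gt// lt_max ltNge t0/=.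
    by case/and3P.
  by case=> -[-> ->] ->.
rewrite service_tail//; last first.
  by apply: (@measurableI _ (g_sigma_algebraType (off n sys))); exact: unfinished_off.
rewrite unfinished_tail//; last exact: unfinished_off.
rewrite [_ `&` unfinished n rec2 0]setIC unfinished_tail//; last exact: unfinished_off.
rewrite setIC -[P _]fineK ?fin_num_measure//; last exact: measurableI.
rewrite -!EFinM /rate !eqxx /= -/(q n) !mulrA -!expRD mulrC; congr (_ * expR _)%:E.
by lra.
Qed.

(** Inclusion-exclusion, the union having probability at most 1. *)
Lemma unfinished_sum_le n : p n rec1 + p n rec2 <= 1 + q n.
Proof.
have := @probability_le1 _ _ _ P (unfinished n rec1 0 `|` unfinished n rec2 0).
have -> : (P (unfinished n rec1 0 `|` unfinished n rec2 0) =
    P (unfinished n rec1 0) + P (unfinished n rec2 0)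
    - P (unfinished n rec1 0 `&` unfinished n rec2 0))%E.
  by apply: measureUfinl => //; rewrite (le_lt_trans (probability_le1 _ _)) ?ltry.
rewrite -[P (unfinished n rec1 0)]fineK ?fin_num_measure//.
rewrite -[P (unfinished n rec2 0)]fineK ?fin_num_measure//.
rewrite -[P (_ `&` _)]fineK ?fin_num_measure//; last exact: measurableI.
by rewrite -lerBlDr -lee_fin; apply; exact: measurableU.
Qed.

Lemma ae_service_ge0 : {ae P, forall w, forall s n, 0 <= S w s n}.
Proof.
have ae_s s : {ae P, forall w, forall n, 0 <= S w s n}.
  apply: ae_foralln => n.
  have mS0 : measurable [set w | 0 < S w s n] by exact: measurable_set_ltr.
  have PS0 : P (~` [set w | 0 < S w s n]) = 0%E.
    rewrite probability_setC//; have := service_tail (@offT n s) (lexx 0).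
    by rewrite setTI mulr0 expR0 mul1e probability_setT => ->; rewrite subee.
  exists (~` [set w | 0 < S w s n]); split => //; first exact: measurableC.
  by move=> w /= /negP; rewrite -ltNge => S0 /lt_trans/(_ S0); rewrite ltxx.
near=> w => s; elim/server_ind: s.
- by near: w; exact: ae_s.
- by near: w; exact: ae_s.
- by near: w; exact: ae_s.
Unshelve. all: by end_near.
Qed.

(** Means in [drift_balance], with [unfinished_sum_le], give [2 * N / mu + 2 * Q / nu <= (N + Q) *
    (1 / (gamma + mu) + 1 / mu)] for [Q] the sum of the [q n]; it remains to solve for [Q]. *)
Lemma unfinished_cesaro N :
  N%:R * (gamma * (gamma + 2 * mu) / (gamma * (gamma + 2 * mu) + 2 * mu ^+ 2))
  <= \sum_(n < N) q n.
Proof.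
pose nu := gamma + 2 * mu.
have := ae_has_mean_le
  (has_mean_sum N (fun n => has_meanD (has_meanD (has_meanD
    (mean_min_residuals n) (mean_min_residuals n))
    (mean_service n rec1)) (mean_service n rec2)))
  (has_mean_sum N (fun n => has_meanD (has_meanD (has_meanD
    (@mean_min_residual n rec1 isT) (@mean_min_residual n rec2 isT))
    (mean_residual n rec1)) (mean_residual n rec2))).
have ae_balance : {ae P, forall w, \sum_(n < N)
    (Num.min (A n w) (Num.min (X n rec1 w) (X n rec2 w))
     + Num.min (A n w) (Num.min (X n rec1 w) (X n rec2 w))
     + Num.max 0 (S w rec1 n) + Num.max 0 (S w rec2 n))
  <= \sum_(n < N) (Num.min (A n w) (X n rec1 w) + Num.min (A n w) (X n rec2 w)
     + X n rec1 w + X n rec2 w)}.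
  apply: filterS ae_service_ge0 => w S0.
  have := @drift_balance _ (e w) (S w) S0 N.
  by congr (_ <= _); apply: eq_bigr => n _; rewrite /A !(max_idPr (S0 _ _)).
move=> /(_ ae_balance) {ae_balance}; rewrite /rate /= => balance.
have {}balance : \sum_(n < N) (q n / nu + q n / nu + mu^-1 + mu^-1) <=
    \sum_(n < N) ((1 + q n) * ((gamma + mu)^-1 + mu^-1)).
  apply: le_trans balance _; apply: ler_sum => n _.
  rewrite [leLHS](_ : _ = (p n rec1 + p n rec2) * ((gamma + mu)^-1 + mu^-1));
    last by ring.
  by rewrite ler_wpM2r ?unfinished_sum_le// addr_ge0// invr_ge0 ?addr_ge0// ltW.
move: balance; rewrite !big_split/= -!mulr_suml big_split/= !sumr_const card_ord.
set Q := \sum_(n < N) q n => balance.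
(* The coefficient of [Q] after collecting terms, over a common denominator that makes its
   positivity visible. *)
pose K := (gamma * nu + 2 * mu ^+ 2) / (mu * (gamma + mu) * nu).
have nu0 : 0 < nu by rewrite addr_gt0// mulr_gt0.
have gm0 : 0 < gamma + mu by rewrite addr_gt0.
have den0 : 0 < gamma * nu + 2 * mu ^+ 2.
  by rewrite addr_gt0// mulr_gt0// exprn_gt0.
have K0 : 0 < K by rewrite divr_gt0// !mulr_gt0.
have KE : K = (gamma + mu)^-1 + mu^-1 - (nu^-1 + nu^-1).
  by rewrite /K /nu; field; rewrite !gt_eqF.
have KbE : gamma * nu / (gamma * nu + 2 * mu ^+ 2) * K = mu^-1 - (gamma + mu)^-1.
  by rewrite /K; field; rewrite !gt_eqF.
rewrite -/nu -(ler_pM2r K0) -[leLHS]mulrA KbE KE.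
by move: balance; rewrite -[mu^-1 *+ N]mulr_natl; lra.
Qed.

(** The measurable events [Q n] replace the type 0 events, which contain them up to a null set. *)
Lemma type0_fraction_ge (f0 : R) :
  {ae P, forall w, fraction (service_type0 (e w) (S w)) @ \oo --> f0} ->
  gamma * (gamma + 2 * mu) / (gamma * (gamma + 2 * mu) + 2 * mu ^+ 2) <= f0.
Proof.
move=> cvg_f0.
pose Q n := unfinished n rec1 0 `&` unfinished n rec2 0.
apply: (@cesaro_indic_le_ae_limit _ _ _ P Q _ _ _ _ _ cvg_f0
  unfinished_cesaro) => [n|].
  exact: measurableI.
apply: filterS ae_service_ge0 => w S0 N; rewrite ler_wpM2r ?invr_ge0//.
apply: ler_sum => n _; rewrite indicE; case: ifPn => [_|/asboolPn ntype0].
  by case: (_ \in _).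
rewrite memNset// => -[]; rewrite /unfinished/= !addr0 => l1 l2; apply: ntype0.
exact: service_type0_lead.
Qed.

End Expectations.

(** * Complementarity of the two types and the final bounds *)

Lemma fraction_type01 (R : realType) (e : nat -> R) (S : 'I_3 -> nat -> R) N :
  (0 < N)%N ->
  fraction (service_type0 e S) N + fraction (service_type1 e S) N = 1 :> R.
Proof.
move=> N0; rewrite /fraction -mulrDl -big_split/= (eq_bigr (fun=> 1)).
  by rewrite sumr_const card_ord divff// pnatr_eq0 -lt0n.
move=> n _; rewrite /service_type0 asbool_neg.
by case: `[< _ >]; rewrite /= ?addr0 ?add0r.
Qed.

Unset Implicit Arguments.

(* V (n, 0) : interarrival time before request n  (Exp(lambda));
   V (n, 1) : service time of request n at the systematic server (Exp(gamma));
   V (n, 2), V (n, 3) : service times of request n at the two recovery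
   servers (Exp(mu)). *)
Theorem theorem6 (R : realType) (d : measure_display) (T : measurableType d)
    (P : probability T R) (lambda gamma mu : R)
    (V : nat * 'I_4 -> {RV P >-> R}) (f0 f1 : R) :
  0 < lambda -> 0 < gamma -> 0 < mu ->
  mutually_independent V ->
  (forall n A, measurable A ->
     distribution P (V (n, 0)) A = exponential_prob lambda A) ->
  (forall n A, measurable A ->
     distribution P (V (n, 1)) A = exponential_prob gamma A) ->
  (forall n (i : 'I_4), (2 <= i)%N -> forall A, measurable A ->
     distribution P (V (n, i)) A = exponential_prob mu A) ->
  let e w n := V (n, 0) w in
  let S w (s : 'I_3) n := V (n, lift ord0 s) w in
  {ae P, forall w, fraction (service_type0 (e w) (S w)) @ \oo --> f0} ->
  {ae P, forall w, fraction (service_type1 (e w) (S w)) @ \oo --> f1} ->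
  let nu := gamma + 2 * mu in
  gamma * nu / (gamma * nu + 2 * mu ^+ 2) <= f0 /\
  f1 <= 2 * mu ^+ 2 / (gamma * nu + 2 * mu ^+ 2).
Proof.
move=> lambda0 gamma0 mu0 indepV _ distr1 distr2 e S cvg_f0 cvg_f1 nu.
have distrV n s A : measurable A -> distribution P (V (n, lift ord0 s)) A =
    exponential_prob (if s == sys then gamma else mu) A.
  move=> mA; elim/server_ind: s => /=.
  - by rewrite -(distr1 n)//; congr (distribution P (V (n, _)) A); exact: val_inj.
  - exact: distr2.
  - exact: distr2.
have bound0 : gamma * nu / (gamma * nu + 2 * mu ^+ 2) <= f0.
  exact: type0_fraction_ge gamma0 mu0 indepV distrV _ cvg_f0.
split=> //.
have f01 : f0 + f1 = 1.
  (* The two almost sure limits hold together at some sample point, where the fractions add up to 1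
     for all [N > 0]. *)
  have [w [cvg0 cvg1]] : exists w,
      fraction (service_type0 (e w) (S w)) @ \oo --> f0 /\
      fraction (service_type1 (e w) (S w)) @ \oo --> f1.
    apply: (@filter_ex _ (almost_everywhere P)).
      apply: ae_properfilter_algebraOfSetsType.
      by rewrite [ltRHS](probability_setT P) lte01.
    by apply: filterS2 cvg_f0 cvg_f1 => w; split.
  rewrite -(cvg_lim _ (cvgD cvg0 cvg1))//; apply/cvg_lim => //.
  apply: cvg_near_cst; near=> N; apply: fraction_type01.
  by near: N; exact: nbhs_infty_gt.
have den0 : 0 < gamma * nu + 2 * mu ^+ 2.
  by rewrite /nu; nra.
have -> : 2 * mu ^+ 2 / (gamma * nu + 2 * mu ^+ 2) =
    1 - gamma * nu / (gamma * nu + 2 * mu ^+ 2).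
  by field; rewrite gt_eqF.
by lra.
Unshelve. all: by end_near.
Qed.
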